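(* Let $X$ be a both-sided rumple. Then $(L_xL_y^{-1})^4=1=(R_xR_y^{-1})^4$ for every $x,y\in X$.
   Context: A left quasigroup is a binary algebra $(X,\cdot)$ in which all left translations $L_x:y\mapsto xy$ are bijections of $X$. A both-sided rumple is a left quasigroup satisfying both identities $(xy)(xz)=(yx)(yz)$ and $(zx)(yx)=(zy)(xy)$ for all $x,y,z$. Equivalently (as shown in the paper), it is a quasigroup satisfying both identities, in which the squaring map is then a bijection; in particular all right translations $R_x:y\mapsto yx$ are bijections of $X$. Here $1$ denotes the identity permutation of $X$. *)

(* Defs.v *)
From mathcomp Require Export all_boot.
From mathcomp Require Export classical_sets functions.

Set Implicit Arguments.
Unset Strict Implicit.
Unset Printing Implicit Defensive.

Local Open Scope classical_set_scope.

Definition left_quasigroup (X : Type) (op : X -> X -> X) : Prop :=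
  forall x, bijective (op x).

Record both_sided_rumple (X : Type) (op : X -> X -> X) : Prop :=
  BothSidedRumple {
    bsr_left_quasigroup : left_quasigroup op;
    bsr_left_rump : forall x y z,
      op (op x y) (op x z) = op (op y x) (op y z);
    bsr_right_rump : forall x y z,
      op (op z x) (op y x) = op (op z y) (op x y) }.

(* The definition only makes left translations bijective. Right
   translations are bijective too, even when X is infinite, as
   right_translation_bij below shows; this is what gives R_y an inverse. *)
Section RightTranslations.

Context (X : Type) (op : X -> X -> X) (rX : both_sided_rumple op).

Local Infix "**" := op (at level 40, left associativity).
Local Notation sq x := (x ** x).

Let A1 x y z : (x ** y) ** (x ** z) = (y ** x) ** (y ** z).
Proof. exact: (bsr_left_rump rX). Qed.

Let A2 x y z : (z ** x) ** (y ** x) = (z ** y) ** (x ** y).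
Proof. exact: (bsr_right_rump rX). Qed.

Let Linj x : injective (op x).
Proof. exact: bij_inj (bsr_left_quasigroup rX x). Qed.

Let Lsurj x z : exists y, x ** y = z.
Proof. by case: (bsr_left_quasigroup rX x) => g _ gK; exists (g z). Qed.

Let sqM1 x y : sq (x ** y) = sq x ** (y ** x).
Proof. by rewrite -A2. Qed.

Let sqM2 x y : sq (x ** y) = y ** x ** sq y.
Proof. by rewrite -A1. Qed.

Let comm_eq p s : p ** s = s ** p -> p = s.
Proof.
move=> e.
have Lps z : p ** z = s ** z by apply: (@Linj (p ** s)); rewrite {2}e A1.
by apply: (@Linj p); rewrite e Lps.
Qed.

Lemma square_inj : injective (fun x => sq x).
Proof.
move=> x y /= e.
have e1 : x ** y = sq x by apply: comm_eq; rewrite -sqM2 sqM1 e.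
by apply: (@Linj x); rewrite e1.
Qed.

Lemma right_translation_inj a : injective (op^~ a).
Proof.
move=> x y /= e; apply: (@Linj a); apply: square_inj.
by rewrite /= !sqM1 e.
Qed.

Lemma square_surj c : exists w, sq w = c.
Proof.
have Rinj := right_translation_inj.
have [d cd] := Lsurj c c.
have [w cw] := Lsurj c (d ** c).
exists w; move: cw; set s := sq c; set e := d ** c => cw.
have se : s ** e = s by rewrite /s /e -sqM1 cd.
have sqe : sq e = c ** s by rewrite /s /e sqM2 cd.
have ce : c ** e = s ** c.
  by apply: (@Rinj s); rewrite /= -sqM2 sqM1 sqe A1 se.
have ec : e ** c = sq s.
  by apply: (@Rinj (c ** s)); rewrite /= -sqM1 -sqe -sqM2 ce.
have es : e ** s = c ** e.
  by apply: square_inj; rewrite /= sqM2 se sqM1 ec.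
by apply: (@Rinj e); rewrite /= -es -{1}cw -sqM1 sqM2 cw.
Qed.

Lemma right_translation_bij a : bijective (op^~ a).
Proof.
rewrite -setTT_bijective; split=> // [x y _ _|b _]; first exact: right_translation_inj.
have [t et] := square_surj (sq a ** b).
have [x ax] := Lsurj a t.
exists x => //; apply: (@Linj (sq a)).
by rewrite -sqM1 ax.
Qed.

End RightTranslations.

Definition L (X : Type) (op : X -> X -> X) (rX : both_sided_rumple op) (x : X) :
    {splitbij [set: X] >-> [set: X]} :=
  bijection_of_bijective (bsr_left_quasigroup rX x).

Definition R (X : Type) (op : X -> X -> X) (rX : both_sided_rumple op) (x : X) :
    {splitbij [set: X] >-> [set: X]} :=
  bijection_of_bijective (right_translation_bij rX x).

(* Main.v *)
Require Import Defs.

(** Write s for squaring. If w u = s p then u p = s w, so the equation is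
    invariant under cyclic rotation of (w, u, p). Hence s is an
    anti-automorphism and s a (a z) = s (s z). With G = L_{ssa} L_{ssb}^-1, this
    makes G send s(ba) z to s(ab) z, and G^2 send s(ab) (sa z) to s(ba) (sb z).
    Since s(ab) (sb z) = s(ba) (sa z), the elements
    s(ba) (sb z) |-> s(ab) (sb z) = s(ba) (sa z) |-> s(ab) (sa z)
    are successive images under G, and two more applications of G return to the
    start. As s is onto, every L_x L_y^-1 is such a G; the claim for right
    translations follows by passing to the opposite operation. *)

Section BothSidedRumple.

Local Set Implicit Arguments.
Local Unset Strict Implicit.

Context (X : Type) (op : X -> X -> X) (rX : both_sided_rumple op).

Local Infix "**" := op (at level 40, left associativity).
Local Notation sq x := (x ** x).

Lemma mul_left_inj x : injective (op x).
Proof. exact: bij_inj (bsr_left_quasigroup rX x). Qed.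

Lemma mul_left_surj x z : exists y, x ** y = z.
Proof. by case: (bsr_left_quasigroup rX x) => g _ gK; exists (g z). Qed.

Lemma sq_mul_l x y : sq (x ** y) = sq x ** (y ** x).
Proof. by rewrite -(bsr_right_rump rX). Qed.

Lemma sq_mul_r x y : sq (x ** y) = y ** x ** sq y.
Proof. by rewrite -(bsr_left_rump rX). Qed.

(** With [u = sq v] and [w = v ** q], the hypothesis says that [sq (q ** v) = sq p], so [p = q ** v]
    and [u ** p] is [sq (v ** q)]. *)
Lemma mul_eq_sq_rot w u p : w ** u = sq p -> u ** p = sq w.
Proof.
have [v <-] := square_surj rX u; have [q <-] := mul_left_surj v w.
rewrite -sq_mul_r => /(square_inj rX) <-.
by rewrite -sq_mul_l.
Qed.

Lemma mul_swap_rot a b p : a ** b = sq p -> a ** p = b ** a.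
Proof.
move=> ab; have bp := mul_eq_sq_rot ab; have pa := mul_eq_sq_rot bp.
(* Multiplied on the left by [b ** p = sq a], both sides become [sq (a ** b)]. *)
apply: (@mul_left_inj (b ** p)).
by rewrite -(bsr_right_rump rX) pa -sq_mul_r sq_mul_l bp.
Qed.

Lemma sq_antimorph a b : sq (b ** a) = sq a ** sq b.
Proof.
have [p /esym ab] := square_surj rX (a ** b).
have pa := mul_eq_sq_rot (mul_eq_sq_rot ab).
by rewrite -(mul_swap_rot ab) sq_mul_l pa.
Qed.

(** A rotation of [sq z ** sq a = sq (a ** z)]. *)
Lemma sq_mul_mul a z : sq a ** (a ** z) = sq (sq z).
Proof. by apply: mul_eq_sq_rot; rewrite -sq_antimorph. Qed.

Lemma mul_mul_sq a b : a ** b ** sq b = sq (sq a).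
Proof. exact: mul_eq_sq_rot (sq_mul_mul a b). Qed.

Lemma mul_mul_swap a b : (a ** b) ** (b ** a) = sq (sq b).
Proof. by apply: mul_eq_sq_rot; rewrite -sq_mul_l. Qed.

Lemma sq_sq_mul_mul a b z :
  sq (sq a) ** (a ** b ** z) = sq (b ** a) ** (sq b ** z).
Proof. by rewrite -(mul_mul_sq a b) (bsr_left_rump rX) -sq_mul_l. Qed.

Lemma sq_sq_mul_swap a b z :
  sq (sq b) ** (a ** b ** z) = sq (sq a) ** (b ** a ** z).
Proof. by rewrite -(mul_mul_swap a b) -(mul_mul_swap b a) (bsr_left_rump rX). Qed.

Lemma sq_mul_sq_swap a b z :
  sq (a ** b) ** (sq b ** z) = sq (b ** a) ** (sq a ** z).
Proof. by rewrite !sq_antimorph (bsr_left_rump rX). Qed.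

Lemma left_displacement_order4 x y (h : X -> X) :
  cancel h (op y) -> iter 4 (op x \o h) =1 id.
Proof.
have [c <-] := square_surj rX x; have [a <-] := square_surj rX c.
have [d <-] := square_surj rX y; have [b <-] := square_surj rX d.
move=> hK; set G := _ \o h.
have GE m : G (sq (sq b) ** m) = sq (sq a) ** m.
  by congr (_ ** _); apply: mul_left_inj (hK _).
have G1 z : G (sq (b ** a) ** z) = sq (a ** b) ** z.
  have [m bm] := mul_left_surj (sq (sq b)) (sq (b ** a) ** z).
  (* By [sq_mul_mul], [sq (sq (a ** b))] sends [sq (a ** b) ** z] to [sq (sq z)], which is also the
     image of [sq (b ** a) ** z] under [sq (sq (b ** a))]. *)
  rewrite -bm GE; apply: (@mul_left_inj (sq (sq (a ** b)))).
  rewrite sq_mul_mul -(sq_mul_mul (sq (b ** a)) z) -bm.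
  by rewrite (sq_antimorph b a) (sq_antimorph a b) sq_mul_sq_swap.
have G2 z : G (G (sq (a ** b) ** (sq a ** z))) = sq (b ** a) ** (sq b ** z).
  (* The intermediate value is [sq (sq a) ** (b ** a ** z)], again a multiple of [sq (sq b)]. *)
  by rewrite -sq_sq_mul_mul GE -sq_sq_mul_swap GE sq_sq_mul_mul.
move=> u; have [v <-] := mul_left_surj (sq (b ** a)) u.
have [z <-] := mul_left_surj (sq b) v.
by rewrite /= G1 sq_mul_sq_swap G1 G2.
Qed.

Lemma opposite_rumple : both_sided_rumple (fun x y => y ** x).
Proof.
split=> [x | x y z | x y z].
- exact: (right_translation_bij rX x).
- exact: (bsr_right_rump rX).
- exact: (bsr_left_rump rX).
Qed.

End BothSidedRumple.

Theorem proposition7p8 (X : Type) (op : X -> X -> X)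
    (rX : both_sided_rumple op) (x y : X) :
  iter 4 (L rX x \o (L rX y)^-1)%FUN =1 id /\
  iter 4 (R rX x \o (R rX y)^-1)%FUN =1 id.
Proof.
split.
- apply: (@left_displacement_order4 _ _ rX x y (L rX y)^-1%FUN) => z.
  exact: (invK (f := L rX y) (in_setT z)).
- apply: (@left_displacement_order4 _ _ (opposite_rumple rX) x y (R rX y)^-1%FUN).
  by move=> z; exact: (invK (f := R rX y) (in_setT z)).
Qed.
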